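(* Let $(M,g_L,Z,\lambda,\rho)$ be a Lyra almost Ricci--Bourguignon soliton on a connected Lyra twisted warped product $M=M_1\times_fM_2$ of dimension $n\ge3$. If $Z$ is Lyra concurrent, then $g_L$ is Einstein, $\operatorname{Ric}^L=\mu g_L$ with $\mu$ constant, and $$\lambda=(1-n\rho)\mu+1 .$$ Consequently, every Lyra almost Ricci--Bourguignon soliton admitting a concurrent potential is a Lyra Ricci--Bourguignon soliton (i.e. $\lambda$ is constant). If $\rho\neq\frac1n$, then $\mu=\frac{\lambda-1}{1-n\rho}$. If $\rho=\frac1n$, then $\lambda=1$.
   Context: Lyra twisted warped product: $(M_1,g_1),(M_2,g_2)$ are smooth pseudo-Riemannian manifolds of positive dimensions $n_1,n_2$, $n=n_1+n_2$; $f,\varphi:M_1\times M_2\to(0,\infty)$ are smooth; $M=M_1\times M_2$ carries $g=g_1\oplus f^2g_2$ and $g_L=\varphi^2g$. $\nabla^L,\operatorname{Ric}^L,R^L$ are the Levi-Civita connection, Ricci tensor and scalar curvature of $g_L$. A Lyra almost Ricci--Bourguignon soliton is $(g_L,Z,\lambda,\rho)$ with $Z$ a smooth vector field on $M$, $\lambda\in C^\infty(M)$, $\rho\in\mathbb R$, satisfying $\operatorname{Ric}^L+\frac12\mathcal L_Zg_L=(\lambda+\rho R^L)g_L$; it is a Lyra Ricci--Bourguignon soliton if $\lambda$ is constant. $Z$ is Lyra concurrent if $\nabla^L_AZ=A$ for every vector field $A$ on $M$. $g_L$ is Einstein if $\operatorname{Ric}^L=\mu g_L$ for some constant $\mu\in\mathbb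 R$. *)

(* Defs.v *)
From HB Require Import structures.
From mathcomp Require Import all_boot all_order all_algebra.
From mathcomp Require Import all_classical all_reals all_analysis.
From mathcomp Require Import ring lra.

Set Implicit Arguments.
Unset Strict Implicit.
Unset Printing Implicit Defensive.

Import Order.TTheory GRing.Theory Num.Theory.
Import numFieldNormedType.Exports.

Local Open Scope classical_set_scope.
Local Open Scope ring_scope.

Section Smooth.
Context {R : realType} {n : nat} {W : normedModType R}.

Definition iter_partial (s : seq 'I_n) (h : 'rV[R]_n -> W) : 'rV[R]_n -> W :=
  foldr (fun i k => fun x => 'D_('e_i) k x) h s.

(* C^oo on an open set U. Differentiability (in the sense of Frechet) of every
   iterated partial derivative makes all of them continuous; the values of h
   outside U are irrelevant because U is open. *)
Definition smooth_on (U : set 'rV[R]_n) (h : 'rV[R]_n -> W) : Prop :=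
  forall (s : seq 'I_n) (x : 'rV[R]_n), U x -> differentiable (iter_partial s h) x.

End Smooth.

(* Bare data of an atlas: for every index c, a chart cmap c : cdom c -> R^n and
   its inverse cinv c, both extended by junk values outside their domains. The
   axioms are in smooth_manifold below. *)
Record atlas (R : realType) (M : Type) (n : nat) := Atlas {
  cidx : Type;
  cdom : cidx -> set M;
  cmap : cidx -> M -> 'rV[R]_n;
  cinv : cidx -> 'rV[R]_n -> M }.

Section Manifold.
Context {R : realType} {M : topologicalType} {n : nat}.
Variable A : atlas R M n.

Definition crange (c : cidx A) : set 'rV[R]_n := cmap c @` cdom c.

Definition is_chart (c : cidx A) : Prop :=
  [/\ open (cdom c),
      open (crange c),
      (forall p, cdom c p -> cinv c (cmap c p) = p),
      (forall p, cdom c p -> {for p, continuous (cmap c)}) &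
      (forall x, crange c x -> {for x, continuous (cinv c)})].

Definition smooth_manifold : Prop :=
  [/\ hausdorff_space M,
      @second_countable M,
      (forall c : cidx A, is_chart c),
      (forall p, exists c : cidx A, cdom c p) &
      (forall c c' : cidx A,
         smooth_on (cmap c @` (cdom c `&` cdom c')) (cmap c' \o cinv c))].

Definition smooth_fun (h : M -> R) : Prop :=
  forall c : cidx A, smooth_on (crange c) (h \o cinv c).

(* Tensor fields are given by their components in the coordinate frame of every
   chart. Only the values X c p with p in cdom c are meaningful. *)
Definition vfield := cidx A -> M -> 'rV[R]_n.
Definition tensor2 := cidx A -> M -> 'M[R]_n.

Definition field_eq {V : Type} (X Y : cidx A -> M -> V) : Prop :=
  forall (c : cidx A) (p : M), cdom c p -> X c p = Y c p.

(* The entry (i, j) of jac c c' p is the derivative at p of the j-th coordinate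
   of c' with respect to the i-th coordinate of c. *)
Definition jac (c c' : cidx A) (p : M) : 'M[R]_n :=
  jacobian (cmap c' \o cinv c) (cmap c p).

Definition smooth_vfield (X : vfield) : Prop :=
  (forall c, smooth_on (crange c) (X c \o cinv c)) /\
  (forall c c' p, cdom c p -> cdom c' p -> X c' p = X c p *m jac c c' p).

Definition pseudo_riemannian (g : tensor2) : Prop :=
  [/\ (forall c, smooth_on (crange c) (g c \o cinv c)),
      (forall c c' p, cdom c p -> cdom c' p ->
         g c p = jac c c' p *m g c' p *m (jac c c' p)^T),
      (forall c p, cdom c p -> (g c p)^T = g c p) &
      (forall c p, cdom c p -> g c p \in unitmx)].

Definition pd (c : cidx A) (i : 'I_n) (h : M -> R) (p : M) : R :=
  'D_('e_i) (h \o cinv c) (cmap c p).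

(* christoffel g c k i j is Gamma^k_ij, the k-th component of nabla_(d_i) d_j
   for the Levi-Civita connection nabla of g (see christoffelP). *)
Definition christoffel (g : tensor2) (c : cidx A) (k i j : 'I_n) (p : M) : R :=
  2^-1 * \sum_l invmx (g c p) k l *
    (pd c i (fun q => g c q j l) p + pd c j (fun q => g c q i l) p
     - pd c l (fun q => g c q i j) p).

(* nabla_X Y *)
Definition cov_deriv (g : tensor2) (X Y : vfield) : vfield := fun c p =>
  \row_k \sum_i X c p 0 i *
    (pd c i (fun q => Y c q 0 k) p + \sum_j christoffel g c k i j p * Y c p 0 j).

(* riemann g c l i j k is the l-th component of R(d_i, d_j) d_k, where
   R(X, Y) = [nabla_X, nabla_Y] - nabla_[X, Y]. *)
Definition riemann (g : tensor2) (c : cidx A) (l i j k : 'I_n) (p : M) : R :=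
  pd c i (christoffel g c l j k) p - pd c j (christoffel g c l i k) p
  + \sum_m (christoffel g c l i m p * christoffel g c m j k p
            - christoffel g c l j m p * christoffel g c m i k p).

(* Ric(Y, Z) is the trace of X |-> R(X, Y) Z. *)
Definition ricci (g : tensor2) : tensor2 := fun c p =>
  \matrix_(j, k) \sum_i riemann g c i i j k p.

Definition scalar_curv (g : tensor2) (c : cidx A) (p : M) : R :=
  \sum_j \sum_k invmx (g c p) j k * ricci g c p j k.

Definition lie_deriv (Z : vfield) (g : tensor2) : tensor2 := fun c p =>
  \matrix_(i, j) \sum_k
    (Z c p 0 k * pd c k (fun q => g c q i j) p
     + g c p k j * pd c i (fun q => Z c q 0 k) p
     + g c p i k * pd c j (fun q => Z c q 0 k) p).

Definition almost_ricci_bourguignon (g : tensor2) (Z : vfield)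
    (lambda : M -> R) (rho : R) : Prop :=
  [/\ smooth_vfield Z,
      smooth_fun lambda &
      field_eq (fun c p => ricci g c p + 2^-1 *: lie_deriv Z g c p)
               (fun c p => (lambda p + rho * scalar_curv g c p) *: g c p)].

Definition ricci_bourguignon (g : tensor2) (Z : vfield)
    (lambda : M -> R) (rho : R) : Prop :=
  almost_ricci_bourguignon g Z lambda rho /\
  exists l : R, forall p, lambda p = l.

Definition concurrent (g : tensor2) (Z : vfield) : Prop :=
  forall X : vfield, smooth_vfield X -> field_eq (cov_deriv g X Z) X.

Definition einstein_with (g : tensor2) (mu : R) : Prop :=
  field_eq (ricci g) (fun c p => mu *: g c p).

Lemma pd_sym (g : tensor2) c p i j k :
  is_chart c -> pseudo_riemannian g -> cdom c p ->
  pd c i (fun q => g c q j k) p = pd c i (fun q => g c q k j) p.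
Proof.
case=> _ oR cK _ _ [_ _ gT _] cp; rewrite /pd.
apply: near_eq_derive.
have : nbhs (cmap c p) (crange c) by apply: open_nbhs_nbhs; split => //; exists p.
apply: filterS => _ [q cq <-] /=; rewrite cK //.
by rewrite -{1}(gT _ _ cq) mxE.
Qed.

(* The Christoffel symbols are the only connection coefficients that are
   torsion-free and compatible with the metric. *)
Lemma christoffelP (g : tensor2) c p (G : 'I_n -> 'I_n -> 'I_n -> R) :
  is_chart c -> pseudo_riemannian g -> cdom c p ->
  ((forall k i j, G k i j = G k j i) /\
   (forall i j k, pd c i (fun q => g c q j k) p =
      \sum_m (G m i j * g c p m k + G m i k * g c p j m)))
  <-> (forall k i j, G k i j = christoffel g c k i j p).
Proof.
move=> cc pg cp; have [_ _ gT gU] := pg.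
pose D i j k := pd c i (fun q => g c q j k) p.
have Ds i j k : D i j k = D i k j by exact: pd_sym.
have gs i j : g c p i j = g c p j i by rewrite -{1}(gT _ _ cp) mxE.
pose L (H : 'I_n -> 'I_n -> 'I_n -> R) l i j := \sum_m g c p l m * H m i j.
have LE H i j k :
    \sum_m (H m i j * g c p m k + H m i k * g c p j m) = L H k i j + L H j i k.
  rewrite big_split; congr (_ + _); apply: eq_bigr => m _; last by rewrite mulrC.
  by rewrite mulrC gs.
pose K i j := \col_l (D i j l + D j i l - D l i j).
have chE k i j : christoffel g c k i j p = (2^-1 *: (invmx (g c p) *m K i j)) k 0.
  rewrite /christoffel !mxE; congr (_ * _); apply: eq_bigr => l _.
  by rewrite !mxE.
have LG H i j l : L H l i j = (g c p *m \col_m H m i j) l 0.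
  by rewrite mxE; apply: eq_bigr => m _; rewrite mxE.
split=> [[Gs GD] k i j | GE].
- have LK l : 2 * L G l i j = K i j l 0.
    have Ls a b d : L G a b d = L G a d b.
      by apply: eq_bigr => m _; rewrite Gs.
    rewrite mxE /D !GD !LE (Ls i j l) (Ls j i l) (Ls l j i) (Ls i l j) (Ls j l i).
    rewrite (Ls i j l) (Ls j i l); ring.
  have -> : G k i j = (\col_m G m i j) k 0 by rewrite mxE.
  rewrite chE -[\col_m G m i j](mulKmx (gU _ _ cp)).
  rewrite scalemxAr; congr ((invmx _ *m _) _ _).
  apply/matrixP => l z; rewrite ord1 -LG [RHS]mxE -LK.
  by rewrite mulrA mulVf ?mul1r // pnatr_eq0.
- have LK i j l : L G l i j = 2^-1 * K i j l 0.
    rewrite LG.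
    have -> : \col_m G m i j = 2^-1 *: (invmx (g c p) *m K i j).
      by apply/matrixP => m z; rewrite ord1 -chE mxE GE.
    by rewrite -scalemxAr mulKVmx ?gU // mxE.
  split=> [k i j|i j k].
    rewrite !GE /christoffel; congr (_ * _); apply: eq_bigr => l _; congr (_ * _).
    by rewrite -!/(D _ _ _) (Ds l j i) (addrC (D j i l)).
  rewrite -/(D i j k) LE !LK !mxE (Ds k i j) (Ds j i k) (Ds i k j); lra.
Qed.

End Manifold.

Arguments vfield {R M n} A.
Arguments tensor2 {R M n} A.

Section TwistedProduct.
Context {R : realType} {M1 M2 : topologicalType} {n1 n2 : nat}.
Variables (A1 : atlas R M1 n1) (A2 : atlas R M2 n2).

Definition prod_atlas : atlas R (M1 * M2)%type (n1 + n2) := {|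
  cidx := (cidx A1 * cidx A2)%type;
  cdom := fun c => cdom c.1 `*` cdom c.2;
  cmap := fun c p => row_mx (cmap c.1 p.1) (cmap c.2 p.2);
  cinv := fun c x => (cinv c.1 (lsubmx x), cinv c.2 (rsubmx x)) |}.

(* phi^2 (g1 (+) f^2 g2), with the pullbacks along the projections implicit *)
Definition twisted_metric (g1 : tensor2 A1) (g2 : tensor2 A2)
    (f : M1 * M2 -> R) : tensor2 prod_atlas := fun c p =>
  block_mx (g1 c.1 p.1) 0 0 (f p ^+ 2 *: g2 c.2 p.2).

Definition lyra_metric (phi : M1 * M2 -> R) (g : tensor2 prod_atlas) :
    tensor2 prod_atlas := fun c p => phi p ^+ 2 *: g c p.

End TwistedProduct.

(* Main.v *)
(* For a concurrent field Z, torsion-freeness gives R(X, Y)Z = 0, hence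
   Ric(-, Z) = 0, and L_Z g = 2 g. The soliton equation therefore reads
   Ric = kappa g for a function kappa, so kappa g(-, Z) = 0 and kappa vanishes
   wherever Z does not. At a zero of Z, differentiating Ric(-, Z) = 0 and using
   nabla Z = id gives Ric = 0 directly. So g is Ricci flat, mu = 0, and the
   soliton equation becomes g = lambda g, that is lambda = 1. *)
Require Import Defs.
From HB Require Import structures.
From mathcomp Require Import all_boot all_order all_algebra.
From mathcomp Require Import all_classical all_reals all_analysis.
From mathcomp Require Import ring lra.

Set Implicit Arguments.
Unset Strict Implicit.
Unset Printing Implicit Defensive.

Import Order.TTheory GRing.Theory Num.Theory.
Import numFieldNormedType.Exports.

Local Open Scope classical_set_scope.
Local Open Scope ring_scope.

(** * Functions of class C^k on open sets *)

(** Two inputs are analytic. [concurrent] quantifies over globally defined smooth fields, so reading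
    off the partial derivatives of [Z] at one point requires extending a coordinate vector to a
    global smooth field; this is the purpose of the cut-off function and of the calculus of
    coordinate changes. In a chart, concurrency then becomes the first-order system d_i Z^k =
    delta_ik - sum_j Gamma^k_ij Z^j, and R(X, Y)Z = 0 is its integrability condition, which rests on
    the equality of mixed partial derivatives. The metric may be indefinite, so a nonzero [Z] can be
    null. The case split is therefore on the vector [Z c p] itself, and kappa g(-, Z) = 0 is
    exploited through the invertibility of the matrix of g rather than through g(Z, Z). The twisted
    product enters by showing that the product charts form a smooth Hausdorff atlas and that g_L is
    a pseudo-Riemannian metric on it. *)

Lemma near_eq_differentiable {R : numFieldType} {V W : normedModType R}
    (f g : V -> W) (x : V) :
  {near x, f =1 g} -> differentiable f x -> differentiable g x.
Proof.
move=> fg df; have fgx : f x = g x by exact: nbhs_singleton fg.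
have dc : continuous ('d f x) by exact: diff_continuous.
(* Near [x] the first-order expansion of [f] is also one of [g]; uniqueness of the differential then
   gives ['d g x = 'd f x]. *)
have E : g \o shift x = cst (g x) + 'd f x +o_ 0 id.
  have /eqaddoP fo := diff_locally df; apply/eqaddoP => e e0.
  have fg0 : \forall h \near 0, f (h + x) = g (h + x).
    by move: fg; rewrite (near_shift 0) => /=; apply: filterS => h /=; rewrite subr0.
  by apply: filterS2 fg0 (fo e e0) => h hE; rewrite !fctE /= hE fgx.
by apply/diff_locallyP; rewrite (diff_unique dc E).
Qed.

Section Ck.
Context {R : realType} {n : nat}.
Implicit Types (U V : set 'rV[R]_n).

(** All partial derivatives of order at most [k] are Frechet differentiable on [U], slightly more
    than C^k. The grading supplies an order to induct on: the derivative of a product, inverse or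
    composite involves the original functions again, but one order lower. *)
Fixpoint Ck {W : normedModType R} (k : nat) U (h : 'rV[R]_n -> W) : Prop :=
  (forall x, U x -> differentiable h x) /\
  (if k is k'.+1 then forall i, Ck k' U (fun x => 'D_('e_i) h x) else True).

Lemma smooth_onP {W : normedModType R} U (h : 'rV[R]_n -> W) :
  smooth_on U h <-> forall k, Ck k U h.
Proof.
split=> [hs k|hC s].
- elim: k h hs => [|k IH] h hs; first by split => // x; exact: (hs [::]).
  split=> [x|i]; first exact: (hs [::]).
  apply: IH => s x Ux.
  by have := hs (rcons s i) x Ux; rewrite /iter_partial foldr_rcons.
(* [foldr] lets the last index of [s] differentiate first, and [Ck] also peels off the innermost
   derivative, hence an induction from the right end. *)
- elim/last_ind: s h hC => [|s i IH] h hC x Ux; first by have [+ _] := hC 0; exact.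
  rewrite /iter_partial foldr_rcons; apply: (IH (fun x => 'D_('e_i) h x)) => // k.
  by have [_] := hC k.+1; exact.
Qed.

Lemma Ck_diff {W : normedModType R} k U (h : 'rV[R]_n -> W) x :
  Ck k U h -> U x -> differentiable h x.
Proof. by case: k => [|k] [+ _]; exact. Qed.

Lemma CkW {W : normedModType R} k U (h : 'rV[R]_n -> W) : Ck k.+1 U h -> Ck k U h.
Proof.
elim: k h => [|k IH] h; first by case.
by move=> [hd hD]; split=> // i; apply: IH; exact: hD.
Qed.

Lemma CkS {W : normedModType R} k U V (h : 'rV[R]_n -> W) :
  U `<=` V -> Ck k V h -> Ck k U h.
Proof.
move=> UV; elim: k h => [|k IH] h [hd hD]; first by split=> // x /UV; exact: hd.
by split=> [x /UV|i]; [exact: hd|exact: IH (hD i)].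
Qed.

Lemma eq_Ck {W : normedModType R} k U (f g : 'rV[R]_n -> W) :
  open U -> (forall x, U x -> f x = g x) -> Ck k U f -> Ck k U g.
Proof.
move=> oU; elim: k f g => [|k IH] f g fg [fd fD];
  have fgn x : U x -> {near x, f =1 g} by
    move=> Ux; apply: filterS (open_nbhs_nbhs (conj oU Ux)); exact: fg.
- by split=> // x Ux; apply: near_eq_differentiable (fgn x Ux) (fd x Ux).
- split=> [x Ux|i]; first by apply: near_eq_differentiable (fgn x Ux) (fd x Ux).
  apply: (IH (fun x => 'D_('e_i) f x)) (fD i) => x Ux.
  exact/near_eq_derive/fgn.
Qed.

Lemma Ck_local {W : normedModType R} k U (h : 'rV[R]_n -> W) :
  (forall x, U x -> exists2 V, V x & Ck k V h) -> Ck k U h.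
Proof.
elim: k h => [|k IH] h hV.
- by split=> // x /hV[V Vx [+ _]]; exact.
- split=> [x /hV[V Vx [+ _]]|i]; first exact.
  by apply: IH => x /hV[V Vx [_ hD]]; exists V => //; exact: hD.
Qed.

Lemma Ck_cst {W : normedModType R} k U (a : W) : Ck k U (cst a).
Proof.
elim: k a => [|k IH] a; first by split=> // x _; exact: differentiable_cst.
split=> [x _|i]; first exact: differentiable_cst.
by rewrite (_ : (fun x => _) = cst 0) //; apply/funext => x; exact: derive_cst.
Qed.

Lemma Ck_add {W : normedModType R} k U (f g : 'rV[R]_n -> W) :
  open U -> Ck k U f -> Ck k U g -> Ck k U (fun x => f x + g x).
Proof.
move=> oU; elim: k f g => [|k IH] f g [fd fD] [gd gD].
- by split=> // x Ux; apply: differentiableD; [exact: fd|exact: gd].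
- split=> [x Ux|i]; first by apply: differentiableD; [exact: fd|exact: gd].
  apply: (eq_Ck oU) (IH _ _ (fD i) (gD i)) => x Ux.
  by rewrite [RHS]deriveD//; apply: diff_derivable; [exact: fd|exact: gd].
Qed.

Lemma Ck_sum k U (I : Type) (r : seq I) (P : pred I) (f : I -> 'rV[R]_n -> R) :
  open U -> (forall i, Ck k U (f i)) -> Ck k U (fun x => \sum_(i <- r | P i) f i x).
Proof.
move=> oU fC; elim: r => [|a r IH].
  by under eq_fun do rewrite big_nil; exact: Ck_cst.
under eq_fun do rewrite big_cons.
by case: (P a) => //; exact: Ck_add.
Qed.

Lemma Ck_mul k U (f g : 'rV[R]_n -> R) :
  open U -> Ck k U f -> Ck k U g -> Ck k U (fun x => f x * g x).
Proof.
move=> oU; elim: k f g => [|k IH] f g fC gC.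
  case: fC gC => fd _ [gd _].
  by split=> // x Ux; apply: differentiableM; [exact: fd|exact: gd].
have [[fd fD] [gd gD]] := (fC, gC); have [fC' gC'] := (CkW fC, CkW gC).
split=> [x Ux|i]; first by apply: differentiableM; [exact: fd|exact: gd].
apply: (eq_Ck oU) (Ck_add oU (IH _ _ fC' (gD i)) (IH _ _ gC' (fD i))) => x Ux.
by rewrite [RHS]deriveM//; apply: diff_derivable; [exact: fd|exact: gd].
Qed.

Lemma Ck_opp k U (f : 'rV[R]_n -> R) :
  open U -> Ck k U f -> Ck k U (fun x => - f x).
Proof.
move=> oU fC; rewrite (_ : (fun x => _) = fun x => (-1) * f x).
  exact: Ck_mul oU (Ck_cst _ _ _) fC.
by apply/funext => x; rewrite mulN1r.
Qed.

Lemma CkB k U (f g : 'rV[R]_n -> R) :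
  open U -> Ck k U f -> Ck k U g -> Ck k U (fun x => f x - g x).
Proof. by move=> oU fC gC; apply: (Ck_add oU fC); exact: Ck_opp. Qed.

Lemma Ck_prod k U (I : Type) (r : seq I) (P : pred I) (f : I -> 'rV[R]_n -> R) :
  open U -> (forall i, Ck k U (f i)) -> Ck k U (fun x => \prod_(i <- r | P i) f i x).
Proof.
move=> oU fC; elim: r => [|a r IH].
  by under eq_fun do rewrite big_nil; exact: Ck_cst.
under eq_fun do rewrite big_cons.
by case: (P a) => //; exact: Ck_mul.
Qed.

(** The derivative [- f^-2 * f'] contains only [f^-1], known at order [k] by induction, and a
    derivative of [f]. *)
Lemma Ck_inv k U (f : 'rV[R]_n -> R) :
  open U -> (forall x, U x -> f x != 0) -> Ck k U f -> Ck k U (fun x => (f x)^-1).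
Proof.
move=> oU f0; elim: k f f0 => [|k IH] f f0 fC.
  case: fC => fd _.
  by split=> // x Ux; apply: differentiableV; [exact: fd|exact: f0].
have [fd fD] := fC; have fV := IH f f0 (CkW fC).
split=> [x Ux|i]; first by apply: differentiableV; [exact: fd|exact: f0].
apply: (eq_Ck oU) (Ck_opp oU (Ck_mul oU (Ck_mul oU fV fV) (fD i))) => x Ux.
rewrite [RHS]deriveV ?f0//; last exact/diff_derivable/fd.
by rewrite [RHS]mulNr -exprVn expr2.
Qed.

Lemma differentiable_mx {V : normedModType R} {p q : nat} (M : V -> 'M[R]_(p, q)) x :
  (forall i j, differentiable (fun y => M y i j) x) -> differentiable M x.
Proof.
move=> Md; rewrite (_ : M =
    \sum_(i < p) \sum_(j < q) (fun y => M y i j *: delta_mx i j)).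
  do 2![apply: differentiable_sum => ?]; exact: differentiableZl.
apply/funext => y; rewrite [LHS]matrix_sum_delta fct_sumE.
by apply: eq_bigr => i _; rewrite fct_sumE.
Qed.

Lemma differentiable_entry {V : normedModType R} {p q : nat}
    (M : V -> 'M[R]_(p, q)) x i j :
  differentiable M x -> differentiable (fun y => M y i j) x.
Proof.
move=> Md; apply: (@differentiable_comp _ _ _ _ M (fun N : 'M[R]_(p, q) => N i j)) => //.
exact: differentiable_coord.
Qed.

Lemma Ck_mxP k U {p q : nat} (M : 'rV[R]_n -> 'M[R]_(p, q)) : open U ->
  Ck k U M <-> forall i j, Ck k U (fun x => M x i j).
Proof.
move=> oU; elim: k M => [|k IH] M.
  split=> [[Md _] i j|MC]; split=> // x Ux.
    exact/differentiable_entry/Md.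
  by apply: differentiable_mx => i j; have [+ _] := MC i j; exact.
have DE i j l x : differentiable M x ->
    ('D_('e_l) M x) i j = 'D_('e_l) (fun y => M y i j) x.
  by move=> Md; rewrite derive_mx ?mxE//; exact: diff_derivable.
split=> [[Md MD] i j|MC]; have Md' x (Ux : U x) : differentiable M x.
- exact: Md.
- split=> [x Ux|l]; first exact/differentiable_entry/Md.
  apply: (eq_Ck oU) (((IH _).1 (MD l)) i j) => x Ux.
  exact/DE/Md.
- by apply: differentiable_mx => i j; have [+ _] := MC i j; exact.
- split=> // l; apply/IH => i j.
  have [_ /(_ l)] := MC i j; apply: (eq_Ck oU) => x Ux.
  exact/esym/DE/Md'.
Qed.

Lemma smooth_on_mxP U {p q : nat} (M : 'rV[R]_n -> 'M[R]_(p, q)) : open U ->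
  smooth_on U M <-> forall i j k, Ck k U (fun x => M x i j).
Proof.
move=> oU; rewrite smooth_onP; split=> [MC i j k|MC k].
  exact: (Ck_mxP k M oU).1.
by apply/(Ck_mxP _ _ oU) => i j.
Qed.

Lemma Ck_coord k U j : open U -> Ck k U (fun x : 'rV[R]_n => x 0 j).
Proof.
move=> oU; have dj x : differentiable (fun x : 'rV[R]_n => x 0 j) x.
  exact: differentiable_coord.
case: k => [|k]; first by split.
split=> // i; apply: (eq_Ck oU) (Ck_cst k U (('e_i : 'rV[R]_n) 0 j)) => x _.
have := derive_mx (@derivable_id _ _ x ('e_i : 'rV[R]_n)).
by rewrite derive_id => /matrixP/(_ 0 j); rewrite [RHS]mxE.
Qed.
End Ck.

Lemma derive_rV_comp {R : realType} {V W : normedModType R} {m : nat}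
    (u : V -> 'rV[R]_m) (h : 'rV[R]_m -> W) x v :
  differentiable u x -> differentiable h (u x) ->
  'D_v (h \o u) x = \sum_j 'D_v (fun y => u y 0 j) x *: 'D_('e_j) h (u x).
Proof.
move=> du dh; rewrite deriveE; last exact: differentiable_comp.
rewrite diff_comp //= -[X in 'd h _ X]deriveE //.
rewrite [X in 'd h _ X]row_sum_delta linear_sum; apply: eq_bigr => j _.
rewrite linearZ -deriveE // derive_mx ?mxE //; exact: diff_derivable.
Qed.

Lemma Ck_comp {R : realType} {n m : nat} k (U : set 'rV[R]_n) (V : set 'rV[R]_m)
    (u : 'rV[R]_n -> 'rV[R]_m) (h : 'rV[R]_m -> R) : open U ->
  (forall x, U x -> V (u x)) -> (forall j, Ck k U (fun x => u x 0 j)) ->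
  Ck k V h -> Ck k U (h \o u).
Proof.
move=> oU uV; elim: k h => [|k IH] h uC hC.
  split=> // x Ux; apply: differentiable_comp.
    by apply: differentiable_mx => i j; rewrite (ord1 i); exact: Ck_diff (uC j) Ux.
  exact: Ck_diff hC (uV _ Ux).
have ud x : U x -> differentiable u x.
  by move=> Ux; apply: differentiable_mx => i j; rewrite (ord1 i); exact: Ck_diff (uC j) Ux.
have hd x : U x -> differentiable h (u x) by move=> Ux; exact: Ck_diff hC (uV _ Ux).
split=> [x Ux|i]; first by apply: differentiable_comp; [exact: ud|exact: hd].
pose F j x : R := 'D_('e_i) (fun y => u y 0 j) x * 'D_('e_j) h (u x).
apply: (@eq_Ck _ _ _ _ _ (fun x => \sum_j F j x)) => // [x Ux|].
  by rewrite derive_rV_comp//; [exact: ud|exact: hd].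
apply: Ck_sum => // j; apply: Ck_mul => //.
  by have [_ uD] := uC j; exact: uD.
have [_ hD] := hC.
by apply: (IH (fun y => 'D_('e_j) h y)) => [l|]; [exact: CkW|exact: hD].
Qed.

(** * Symmetry of second derivatives *)

Section Clairaut.
Context {R : realType} {V : normedModType R}.
Implicit Types (h : V -> R) (x y v w : V).

Lemma is_derive_line h y v s :
  derivable h (y + s *: v) v -> is_derive s 1 (fun r => h (y + r *: v)) ('D_v h (y + s *: v)).
Proof.
have E : (fun r => r^-1 *: (((fun r => h (y + r *: v)) \o shift s) (r *: (1 : R))
           - h (y + s *: v))) =
    (fun r => r^-1 *: ((h \o shift (y + s *: v)) (r *: v) - h (y + s *: v))).
  apply/funext => r /=; congr (_ *: (h _ - _)).
  by rewrite [r *: _]mulr1 scalerDl addrCA.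
by move=> hd; split; rewrite /derivable /derive E.
Qed.

Lemma is_derive_shift_fun h c y v :
  derivable h (y + c) v -> is_derive y v (fun z => h (z + c)) ('D_v h (y + c)).
Proof.
have E : (fun r => r^-1 *: (((fun z => h (z + c)) \o shift y) (r *: v) - h (y + c))) =
    (fun r => r^-1 *: ((h \o shift (y + c)) (r *: v) - h (y + c))).
  by apply/funext => r /=; rewrite addrA.
by move=> hd; split; rewrite /derivable /derive E.
Qed.

Lemma MVT_line h y v t : 0 <= t ->
  (forall s, 0 <= s <= t -> derivable h (y + s *: v) v) ->
  exists2 c, 0 <= c <= t & h (y + t *: v) - h y = 'D_v h (y + c *: v) * t.
Proof.
move=> t0 hd.
have [s||c] := @MVT_segment _ (fun r => h (y + r *: v))
    (fun r => 'D_v h (y + r *: v)) 0 t t0.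
- by rewrite in_itv /= => /andP[s0 st]; apply/is_derive_line/hd; rewrite !ltW.
- apply: derivable_within_continuous => s /=; rewrite in_itv /= => s0t.
  by have [] := is_derive_line (hd s s0t).
- by rewrite in_itv /= scale0r addr0 subr0; exists c.
Qed.

(* The right-hand side is asymmetric in [v] and [w] while the left-hand side is
   symmetric: this is what forces the mixed derivatives to agree. *)
Lemma second_difference h x v w t : 0 <= t ->
  (forall a b, 0 <= a <= t -> 0 <= b <= t ->
     derivable h (x + a *: v + b *: w) v /\
     derivable (fun y => 'D_v h y) (x + a *: v + b *: w) w) ->
  exists a b, [/\ 0 <= a <= t, 0 <= b <= t &
    h (x + t *: v + t *: w) - h (x + t *: v) - (h (x + t *: w) - h x) =
    'D_w (fun y => 'D_v h y) (x + a *: v + b *: w) * t * t].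
Proof.
(* The second difference is the increment of [k] along [v]. The mean value theorem along [v] turns
   it into an increment of ['D_v h] along [w], and a second application along [w] produces the mixed
   derivative. *)
move=> t0 hd; pose k y := h (y + t *: w) - h y.
have kd a : 0 <= a <= t -> is_derive (x + a *: v) v k
    ('D_v h (x + a *: v + t *: w) - 'D_v h (x + a *: v)).
  move=> a0t; apply: is_deriveB.
    by apply: is_derive_shift_fun; apply: (hd _ _ a0t _).1; rewrite t0 lexx.
  apply: derivableP; have := (hd a 0 a0t _).1; rewrite scale0r addr0; apply.
  by rewrite lexx t0.
have [a a0t|a a0t] := @MVT_line k x v t t0; first by have [] := kd a a0t.
have [_ ->] := kd a a0t.
have [b b0t|b b0t ->] :=
    @MVT_line (fun y => 'D_v h y) (x + a *: v) w t t0; first exact: (hd _ _ a0t b0t).2.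
by rewrite /k => kE; exists a, b; split.
Qed.

(** Computing one second difference in both orders yields two points near [x] at which the two mixed
    derivatives take the same value; by continuity each is within [e / 2] of its value at [x]. *)
Lemma derive_comm h x v w :
  (\forall y \near x, [/\ derivable h y v, derivable h y w,
     derivable (fun y => 'D_v h y) y w & derivable (fun y => 'D_w h y) y v]) ->
  {for x, continuous (fun y => 'D_w (fun y => 'D_v h y) y)} ->
  {for x, continuous (fun y => 'D_v (fun y => 'D_w h y) y)} ->
  'D_w (fun y => 'D_v h y) x = 'D_v (fun y => 'D_w h y) x.
Proof.
move=> hd cvw cwv; apply/eqP; rewrite -subr_eq0 -normr_le0; apply/ler_addgt0Pl => e e0.
rewrite addr0; have e20 : 0 < e / 2 by rewrite divr_gt0.
have [d /= d0 dP] : exists2 d, 0 < d & forall y, `|x - y| < d ->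
   [/\ [/\ derivable h y v, derivable h y w,
     derivable (fun y => 'D_v h y) y w & derivable (fun y => 'D_w h y) y v],
     `|'D_w (fun y => 'D_v h y) x - 'D_w (fun y => 'D_v h y) y| < e / 2 &
     `|'D_v (fun y => 'D_w h y) x - 'D_v (fun y => 'D_w h y) y| < e / 2].
  have /cvgrPdist_lt/(_ _ e20) c1 := cvw; have /cvgrPdist_lt/(_ _ e20) c2 := cwv.
  have [d d0 dP] := (nbhs_ballP x _).1 (filterI hd (filterI c1 c2)).
  exists d => [//|y xy].
  have /dP[p1 [p2 p3]] : ball x d y by rewrite -ball_normE.
  by split; [exact: p1|exact: p2|exact: p3].
(* This size keeps the whole parallelogram spanned by [t *: v] and [t *: w] at [x] inside the ball
   of radius [d]; the summand 1 keeps the denominator positive when both vectors vanish and makes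
   the inequality strict. *)
pose t := d / (`|v| + `|w| + 1).
have vw0 : 0 < `|v| + `|w| + 1 by rewrite ltr_wpDl// addr_ge0.
have t0 : 0 < t by rewrite divr_gt0.
have near_x a b : 0 <= a <= t -> 0 <= b <= t -> `|x - (x + a *: v + b *: w)| < d.
  move=> /andP[a0 at_] /andP[b0 bt].
  rewrite -addrA opprD addrA subrr add0r normrN (le_lt_trans (ler_normD _ _))//.
  rewrite !normrZ !ger0_norm//.
  rewrite (@le_lt_trans _ _ (t * (`|v| + `|w|)))//.
    by rewrite mulrDr lerD// ler_wpM2r.
  by rewrite /t mulrAC ltr_pdivrMr// ltr_pM2l// ltrDl.
have [a b a0t b0t|a [b [a0t b0t E1]]] := @second_difference h x v w t (ltW t0).
  have [[d1 _ d3 _] _ _] := dP _ (near_x a b a0t b0t).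
  by split; [exact: d1|exact: d3].
have [a' b' a0t' b0t'|a' [b' [a0t' b0t' E2]]] := @second_difference h x w v t (ltW t0).
  rewrite addrAC.
  have [[_ d2 _ d4] _ _] := dP _ (near_x b' a' b0t' a0t').
  by split; [exact: d2|exact: d4].
have aux (p1 p2 p3 p4 A B : R) : p1 - p2 - (p3 - p4) = A * t * t ->
    p1 - p3 - (p2 - p4) = B * t * t -> A = B.
  have -> : p1 - p3 - (p2 - p4) = p1 - p2 - (p3 - p4) by ring.
  move=> -> AB.
  by apply: (mulIf (lt0r_neq0 t0)); exact: (mulIf (lt0r_neq0 t0)).
rewrite (addrAC x (a' *: w)) (addrAC x (t *: w)) in E2.
have E := aux _ _ _ _ _ _ E1 E2.
have [_ d1 _] := dP _ (near_x a b a0t b0t).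
have [_ _ d2] := dP _ (near_x b' a' b0t' a0t').
have close (p q A B : R) : A = B -> `|p - A| < e / 2 -> `|q - B| < e / 2 -> `|p - q| <= e.
  move=> -> pB qB; rewrite -(subrKA B) (le_trans (ler_normD _ _))// (splitr e).
  by rewrite lerD ?[`|B - q|]distrC ?ltW.
exact: close E d1 d2.
Qed.
End Clairaut.

Lemma Ck_derive_comm {R : realType} {n : nat} (U : set 'rV[R]_n) (h : 'rV[R]_n -> R) i j x :
  open U -> Ck 2 U h -> U x ->
  'D_('e_j) (fun y => 'D_('e_i) h y) x = 'D_('e_i) (fun y => 'D_('e_j) h y) x.
Proof.
move=> oU [hd hD] Ux; apply: derive_comm.
- apply: filterS (open_nbhs_nbhs (conj oU Ux)) => y Uy.
  split; apply: diff_derivable; try exact: hd.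
    by have [+ _] := hD i; exact.
  by have [+ _] := hD j; exact.
- have [_ /(_ j)[+ _]] := hD i => /(_ _ Ux); exact: differentiable_continuous.
- have [_ /(_ i)[+ _]] := hD j => /(_ _ Ux); exact: differentiable_continuous.
Qed.

(** * A smooth cut-off function *)

Section Flat.
Context {R : realType}.
Implicit Types (P : {poly R}) (t : R).

(* The functions [flat P] are closed under differentiation, all derivatives at [0]
   vanishing, so [flat 1] is a smooth cut-off function. *)
Definition flat P t : R := if 0 < t then P.[t^-1] * expR (- t^-1) else 0.

(** A single term [s ^+ m / m!] of the exponential series is at most [expR s]. *)
Lemma exprn_expRN_le (m : nat) (s : R) : 0 <= s -> s ^+ m * expR (- s) <= m`!%:R.
Proof.
move=> s0; rewrite expRN ler_pdivrMr ?expR_gt0//.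
case: m => [|m]; first by rewrite expr0 fact0 mul1r (le_trans _ (expR_ge1Dx s))// lerDl.
rewrite mulrC -ler_pdivrMr ?ltr0n ?fact_gt0//.
by rewrite (le_trans _ (expR_ge1Dxn m s0))// lerDr.
Qed.

(** A quadratic bound makes the difference quotient at 0 of order [|t|], so the derivative there is
    0. With [s = t^-1], division by [t ^+ 2] turns the monomial [s ^+ i] into [s ^+ i.+2], whence
    the factorial [(i.+2)!] in the constant. *)
Lemma flat_le P : exists2 C, 0 <= C & forall t, `|flat P t| <= C * t ^+ 2.
Proof.
exists (\sum_(i < size P) `|P`_i| * (i.+2)`!%:R); first exact: sumr_ge0.
move=> t; rewrite /flat; case: ltP => [t0|_]; last first.
  by rewrite normr0 mulr_ge0 ?sqr_ge0// sumr_ge0.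
rewrite -ler_pdivrMr ?exprn_gt0//.
rewrite normrM (ger0_norm (expR_ge0 _)) horner_coef -mulrA -exprVn.
have s0 : 0 <= t^-1 by rewrite invr_ge0 ltW.
rewrite (le_trans (ler_wpM2r _ (ler_norm_sum _ _ _)))//.
  by rewrite mulr_ge0 ?expR_ge0 ?exprn_ge0.
rewrite mulr_suml; apply: ler_sum => i _.
rewrite normrM normrX (ger0_norm s0) -mulrA ler_wpM2l//.
by rewrite mulrCA -exprD addn2 mulrC exprn_expRN_le.
Qed.

Lemma is_derive_flat P t : is_derive t 1 (flat P) (flat ('X^2 * (P - P^`())) t).
Proof.
have [t0|t0|<-] := ltgtP 0 t.
- apply: (@near_eq_is_derive R R R (fun s => P.[s^-1] * expR (- s^-1))).
    near=> s; rewrite /flat ifT//; near: s; exact: lt_nbhsr.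
  have iV : is_derive t 1 (fun s : R => s^-1) (- t^-2).
    split; first by apply: derivableV; rewrite ?gt_eqF//; exact: derivable_id.
    by rewrite deriveV ?gt_eqF// derive_id scaler1.
  have dP := is_derive1_comp (is_derive_poly P t^-1) iV.
  have dN : is_derive t 1 (fun s : R => - s^-1) (- - t^-2) := is_deriveN iV.
  have dE := @is_derive1_comp _ expR _ t _ _ (is_derive_expR _) dN.
  apply: is_derive_eq (is_deriveM dP dE) _.
  rewrite /flat t0 hornerM hornerXn hornerD hornerN /= opprK exprVn.
  rewrite /GRing.scale /=.
  ring.
- apply: (@near_eq_is_derive R R R (cst 0)).
    near=> s; rewrite /flat ifF//; apply/negbTE; rewrite -leNgt ltW//.
    near: s; exact: lt_nbhsl.
  rewrite /flat ltNge (ltW t0) /=; exact: is_derive_cst.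
- have [C C0 FC] := flat_le P.
  have F0 : flat P 0 = 0 by rewrite /flat ltxx.
  rewrite [flat ('X^2 * _) 0]/flat ltxx.
  suff cv : (fun h => h^-1 *: ((flat P \o shift 0) (h *: 1) - flat P 0)) @ 0^' --> (0 : R).
    by split; [apply/cvg_ex; exists 0|exact: cvg_lim].
  apply/cvgrPdist_lt => e e0; near=> h.
  have h0 : h != 0 by near: h; exact: nbhs_dnbhs_neq.
  rewrite sub0r normrN F0 subr0 /= addr0 [h *: _]mulr1 normrZ normfV.
  rewrite ltr_pdivrMl ?normr_gt0// (le_lt_trans (FC h))//.
  rewrite -real_normK ?num_real// expr2 mulrA [ltRHS]mulrC ltr_pM2r ?normr_gt0//.
  rewrite (@le_lt_trans _ _ ((C + 1) * `|h|))//; first by rewrite ler_wpM2r// lerDl.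
  rewrite -ltr_pdivlMl ?ltr_wpDl// mulrC.
  near: h; apply: dnbhs0_lt; rewrite divr_gt0// ltr_wpDl//.
Unshelve. all: by end_near. Qed.

Lemma flat1_eq0 t : (flat 1 t == 0) = (t <= 0).
Proof.
by rewrite /flat hornerC mul1r; case: ltP => _; [rewrite gt_eqF ?expR_gt0|exact: eqxx].
Qed.

Lemma Ck_flat {n : nat} k (U : set 'rV[R]_n) P (u : 'rV[R]_n -> R) :
  open U -> Ck k U u -> Ck k U (fun x => flat P (u x)).
Proof.
move=> oU; have fd Q x : differentiable (flat Q) x.
  by apply/derivable1_diffP; have [] := is_derive_flat Q x.
elim: k P => [|k IH] P uC.
  by split=> // x Ux; apply: differentiable_comp => //; exact: Ck_diff uC Ux.
split=> [x Ux|i]; first by apply: differentiable_comp => //; exact: Ck_diff uC Ux.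
have [ud uD] := uC.
apply: (eq_Ck oU) (Ck_mul oU (uD i) (IH ('X^2 * (P - P^`())) (CkW uC))) => x Ux.
rewrite /= [RHS]deriveE; last by apply: differentiable_comp => //; exact: ud.
rewrite diff_comp ?diff1E//=; [|exact: ud..].
rewrite derive1E; have [_ ->] := is_derive_flat P (u x); rewrite -deriveE//; exact: ud.
Qed.
End Flat.

(** * Coordinate changes and extension of tangent vectors *)

Section Charts.
Context {R : realType} {M : topologicalType} {n : nat}.
Variable A : atlas R M n.
Implicit Types (c : cidx A) (p q : M).

Definition transition c c' := cmap c' \o cinv c.

Definition overlap c c' : set 'rV[R]_n := cmap c @` (cdom c `&` cdom c').

(** Inside the open range, the image is the preimage of [D] under [cinv c], which is continuous
    there. *)
Lemma chart_open c (D : set M) : is_chart c -> open D -> open (cmap c @` (cdom c `&` D)).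
Proof.
case=> _ oR cK _ cc oD; rewrite openE => _ [q [cq Dq] <-].
have xR : crange c (cmap c q) by exists q.
have := cc _ xR D; rewrite /= cK// => /(_ (open_nbhs_nbhs (conj oD Dq))) nD.
apply: filterS2 (open_nbhs_nbhs (conj oR xR)) nD => _ [q' cq' <-] /=.
by rewrite cK// => Dq'; exists q'.
Qed.

Lemma transition_overlap c c' x : is_chart c -> is_chart c' -> overlap c c' x ->
  overlap c' c (transition c c' x).
Proof.
by move=> [_ _ cK _ _] _ [q [cq c'q] <-]; rewrite /transition /= cK//; exists q.
Qed.

Hypothesis charts : forall c : cidx A, is_chart c.
Hypothesis smooth_transition : forall c c', smooth_on (overlap c c') (transition c c').

Let cinvK c p : cdom c p -> cinv c (cmap c p) = p.
Proof. by have [_ _ cK _ _] := charts c; exact: cK. Qed.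

Lemma overlap_open c c' : open (overlap c c').
Proof. by apply: chart_open => //; have [] := charts c'. Qed.

Let overlap_nbhs c c' p : cdom c p -> cdom c' p -> nbhs (cmap c p) (overlap c c').
Proof.
move=> cp c'p; apply: open_nbhs_nbhs; split; first exact: overlap_open.
by exists p.
Qed.

Let transition_diff c c' p : cdom c p -> cdom c' p ->
  differentiable (transition c c') (cmap c p).
Proof. move=> cp c'p; have /smooth_onP/(_ 0)[+ _] := @smooth_transition c c'.
by apply; exists p. Qed.

Let Ck_transition k c c' j : Ck k (overlap c c') (fun x => transition c c' x 0 j).
Proof.
by have /(smooth_on_mxP _ (@overlap_open c c')) := @smooth_transition c c'; exact.
Qed.

Lemma mul_jac c c' p (v : 'rV[R]_n) : cdom c p -> cdom c' p ->
  v *m jac c c' p = 'D_v (transition c c') (cmap c p).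
Proof. by move=> cp c'p; rewrite deriveEjacobian//; exact: transition_diff. Qed.

Lemma mul_jacE c c' p (v : 'rV[R]_n) j : cdom c p -> cdom c' p ->
  (v *m jac c c' p) 0 j = \sum_i v 0 i * 'D_('e_i) (fun x => transition c c' x 0 j) (cmap c p).
Proof.
move=> cp c'p; rewrite mxE; apply: eq_bigr => i _; congr (_ * _).
transitivity ((('e_i : 'rV[R]_n) *m jac c c' p) 0 j); first by rewrite -rowE [RHS]mxE.
rewrite mul_jac// derive_mx ?mxE//.
exact/diff_derivable/transition_diff.
Qed.

Lemma jac_id c p : cdom c p -> jac c c p = 1%:M.
Proof.
move=> cp; apply/row_matrixP => i; rewrite !rowE mulmx1 mul_jac//.
rewrite -[RHS](@derive_id _ _ (cmap c p)); apply: near_eq_derive.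
by apply: filterS (overlap_nbhs cp cp) => _ [q [cq _] <-]; rewrite /transition /= cinvK.
Qed.

(** The cocycle relation is the chain rule, since [transition c c''] and
    [transition c' c'' \o transition c c'] agree on [overlap c c']. It is what makes a vector
    transported out of one chart obey the transformation law of a field. *)
Lemma jac_comp c c' c'' p : cdom c p -> cdom c' p -> cdom c'' p ->
  jac c c'' p = jac c c' p *m jac c' c'' p.
Proof.
move=> cp c'p c''p; apply/row_matrixP => i; rewrite !rowE mulmxA.
transitivity ('D_('e_i) (transition c c'') (cmap c p)); first exact: mul_jac.
transitivity ('D_('e_i *m jac c c' p) (transition c' c'') (cmap c' p)); last first.
  exact/esym/mul_jac.
have e_jac := mul_jac 'e_i cp c'p; rewrite e_jac.
have tp : transition c c' (cmap c p) = cmap c' p by rewrite /transition /= cinvK.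
rewrite (@near_eq_derive _ _ _ _ (transition c' c'' \o transition c c')); last first.
  apply: filterS (overlap_nbhs cp c'p) => _ [q [cq c'q] <-].
  by rewrite /transition /= !cinvK.
have d1 := transition_diff cp c'p; have d2 := transition_diff c'p c''p.
rewrite -tp in d2.
by rewrite deriveE ?diff_comp//=; [rewrite -!deriveE// tp|exact: differentiable_comp].
Qed.

(** * Extension of a tangent vector to a global smooth field *)

Section Bump.
Hypothesis hM : hausdorff_space M.
Variables (c : cidx A) (p : M) (v : 'rV[R]_n).
Hypothesis cp : cdom c p.

(** A closed box is compact as a product of segments, and it contains the Euclidean ball of radius
    [r] on which the bump function will be nonzero. *)
Let cube (r : R) : set 'rV[R]_n :=
  [set x | forall i, `[cmap c p 0 i - r, cmap c p 0 i + r]%classic (x 0 i)].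

Let cube_in : exists2 r : R, 0 < r & cube r `<=` crange c.
Proof.
have [_ oR _ _ _] := charts c.
have /nbhs_ballP[r /= r0 rR] : nbhs (cmap c p) (crange c).
  by apply: open_nbhs_nbhs; split => //; exists p.
exists (r / 2); first by rewrite divr_gt0.
move=> x cx; apply: rR; rewrite -ball_normE /=.
rewrite [ltLHS]/Num.Def.normr/= mx_normrE; apply: (@le_lt_trans _ _ (r / 2)).
  apply: bigmax_le => [|[i j] _ /=]; first by rewrite divr_ge0// ltW.
  rewrite !mxE (ord1 i); have := cx j; rewrite /= in_itv /= => /andP[].
  rewrite ler_norml; lra.
by rewrite ltr_pdivrMr// ltr_pMr// ltr1n.
Qed.

(* The coordinate field of [c] multiplied by a bump function whose support [K] is
   compact in [cdom c]: the extension by [0] is smooth because [K] is closed in [M],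
   which is where the Hausdorff property is needed. *)
Lemma exists_vfield : exists2 X : vfield A, smooth_vfield X & X c p = v.
Proof.
have [r r0 rR] := cube_in; pose x0 := cmap c p.
pose K := cinv c @` cube r.
have cK : closed K.
  apply: (compact_closed hM); apply: continuous_compact; last first.
    apply: (@rV_compact _ _ (fun i => `[cmap c p 0 i - r, cmap c p 0 i + r]%classic)) => i.
    exact: segment_compact.
  apply: continuous_in_subspaceT => x; rewrite inE => /rR xR.
  by have [_ _ _ _] := charts c; exact.
(* The squared Euclidean distance is polynomial, hence smooth, unlike the sup norm of ['rV[R]_n].
   Dividing by [flat 1 (r ^+ 2)] below normalizes the bump to 1 at [x0]. *)
pose s (x : 'rV[R]_n) := r ^+ 2 - \sum_i (x 0 i - x0 0 i) ^+ 2.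
pose b x := flat 1 (s x) / flat 1 (r ^+ 2).
have bC k : Ck k setT b.
  have oT : open [set: 'rV[R]_n] by exact: openT.
  apply: Ck_mul => //; last exact: Ck_cst.
  apply: Ck_flat => //; apply: CkB => //; first exact: Ck_cst.
  apply: Ck_sum => // i; have tC := CkB oT (Ck_coord k i oT) (Ck_cst k setT (x0 0 i)).
  by under eq_fun do rewrite expr2; exact: Ck_mul.
have b0 : b x0 = 1.
  rewrite /b /s big1 => [|i _]; last by rewrite subrr expr0n.
  by rewrite subr0 divff// flat1_eq0 -ltNge exprn_gt0.
have bK x : ~ cube r x -> b x = 0.
  move=> nx; suff /eqP fs : flat 1 (s x) == 0 by rewrite /b fs mul0r.
  rewrite flat1_eq0 leNgt; apply/negP => sx; apply: nx => i.
  have : (x 0 i - x0 0 i) ^+ 2 < r ^+ 2.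
    rewrite -subr_gt0 (lt_le_trans sx)// lerD2l lerN2 (bigD1 i)//= lerDl.
    by apply: sumr_ge0 => j _; exact: sqr_ge0.
  rewrite -[(_ - _) ^+ 2]real_normK ?num_real// ltr_pXn2r ?nnegrE ?(ltW r0)//.
  rewrite ltr_norml /x0 /= in_itv /= => /andP[]; lra.
have KN q : cdom c q -> ~ K q -> b (cmap c q) = 0.
  by move=> cq Kq; apply: bK => xc; apply: Kq; exists (cmap c q); rewrite ?cinvK.
pose X : vfield A := fun c' q =>
  if `[< cdom c q >] then b (cmap c q) *: (v *m jac c c' q) else 0.
exists X; last by rewrite /X asboolT// b0 scale1r jac_id// mulmx1.
split=> [c'|c' c'' q c'q c''q]; last first.
  rewrite /X; case: asboolP => cq; last by rewrite mul0mx.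
  have jE := jac_comp cq c'q c''q; rewrite jE mulmxA; exact: scalemxAl.
have [_ oR _ _ _] := charts c'; apply/(smooth_on_mxP _ oR) => i j k; rewrite (ord1 i).
(* Two open sets cover the range of [c']: the overlap with [c], where [X] is built from smooth maps,
   and the image of the complement of [K], where [X] is 0, because [b] vanishes off the box or by
   the default value. A point outside [cdom c] falls in the second, as [K] lies in [cdom c]. *)
apply: Ck_local => _ [q c'q <-]; have [cq|cq] := pselect (cdom c q).
  exists (overlap c' c); first by exists q.
  have oO := @overlap_open c' c.
  have trO x : overlap c' c x -> overlap c c' (transition c' c x).
    exact: transition_overlap.
  have C2 l := @Ck_transition k c' c l.
  pose F l (x : 'rV[R]_n) : R := v 0 l *
    ((fun y => 'D_('e_l) (fun z => transition c c' z 0 j) y) \o transition c' c) x.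
  apply: (@eq_Ck _ _ _ _ _ (fun x => (b \o transition c' c) x * \sum_l F l x)) => //.
    move=> _ [q' [c'q' cq'] <-].
    rewrite /X /= cinvK// asboolT// [RHS]mxE mul_jacE//.
    by rewrite /F /transition /= cinvK.
  apply: Ck_mul => //; first by apply: (Ck_comp oO _ C2 (bC k)).
  apply: Ck_sum => // l; apply: Ck_mul => //; first exact: Ck_cst.
  apply: (Ck_comp oO trO C2).
  by have [_ D] := @Ck_transition k.+1 c c' j; exact: D.
have oK : open (~` K) by rewrite openC.
exists (cmap c' @` (cdom c' `&` ~` K)).
  exists q => //; split=> // -[x /rR [q' cq' <-]]; rewrite cinvK// => E.
  by apply: cq; rewrite -E.
apply: (@eq_Ck _ _ _ _ _ (cst 0)); [exact: chart_open| |exact: Ck_cst].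
move=> _ [q' [c'q' Kq'] <-]; rewrite /X /= cinvK//.
by case: asboolP => cq'; rewrite ?KN// ?scale0r mxE.
Qed.
End Bump.
End Charts.

(** * Product charts and the Lyra metric *)

Lemma continuous_rV {K : realType} {T : topologicalType} {n : nat}
    (u : T -> 'rV[K]_n) (x : T) :
  (forall j, {for x, continuous (fun y => u y 0 j)}) -> {for x, continuous u}.
Proof.
move=> uc; apply/cvgrPdist_le => e e0.
have un : \forall y \near x, forall j, `|u x 0 j - u y 0 j| <= e.
  apply: filter_forall => j.
  by have /cvgrPdist_le := uc j; apply.
apply: filterS un => y uy; rewrite [leLHS]/Num.Def.normr/= mx_normrE.
by apply: bigmax_le => [|[i j] _ /=]; rewrite ?(ltW e0)// !mxE (ord1 i).
Qed.

Lemma hausdorff_prod (T1 T2 : topologicalType) :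
  hausdorff_space T1 -> hausdorff_space T2 -> hausdorff_space (T1 * T2)%type.
Proof.
move=> h1 h2 [p1 p2] [q1 q2] pq; congr (_, _).
- apply: h1 => B C pB qC.
  have [] := pq (B `*` setT) (C `*` setT).
  + by exists (B, setT) => //; split => //; exact: filterT.
  + by exists (C, setT) => //; split => //; exact: filterT.
  + by case=> a b [[/= ? _] [? _]]; exists a.
- apply: h2 => B C pB qC.
  have [] := pq (setT `*` B) (setT `*` C).
  + by exists (setT, B) => //; split => //; exact: filterT.
  + by exists (setT, C) => //; split => //; exact: filterT.
  + by case=> a b [[/= _ ?] [_ ?]]; exists b.
Qed.

Section RowMx.
Context {R : realType} {n1 n2 : nat}.

Lemma Ck_lsubmx k (U : set 'rV[R]_n1) (h : 'rV[R]_n1 -> R) :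
  open U -> Ck k U h -> Ck k (lsubmx @^-1` U) (fun x : 'rV[R]_(n1 + n2) => h (lsubmx x)).
Proof.
move=> oU hC; have oV : open (lsubmx @^-1` U : set 'rV[R]_(n1 + n2)).
  by apply: open_comp => // x _; exact: continuous_lsubmx.
apply: (Ck_comp oV _ _ hC) => // j; under eq_fun do rewrite mxE.
exact: Ck_coord.
Qed.

Lemma Ck_rsubmx k (U : set 'rV[R]_n2) (h : 'rV[R]_n2 -> R) :
  open U -> Ck k U h -> Ck k (rsubmx @^-1` U) (fun x : 'rV[R]_(n1 + n2) => h (rsubmx x)).
Proof.
move=> oU hC; have oV : open (rsubmx @^-1` U : set 'rV[R]_(n1 + n2)).
  by apply: open_comp => // x _; exact: continuous_rsubmx.
apply: (Ck_comp oV _ _ hC) => // j; under eq_fun do rewrite mxE.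
exact: Ck_coord.
Qed.

Lemma derive_row_mx {m1 m2 : nat} (u1 : 'rV[R]_n1 -> 'rV[R]_m1) (u2 : 'rV[R]_n2 -> 'rV[R]_m2)
    (x v : 'rV[R]_(n1 + n2)) :
  differentiable u1 (lsubmx x) -> differentiable u2 (rsubmx x) ->
  'D_v (fun y : 'rV[R]_(n1 + n2) => row_mx (u1 (lsubmx y)) (u2 (rsubmx y))) x =
  row_mx ('D_(lsubmx v) u1 (lsubmx x)) ('D_(rsubmx v) u2 (rsubmx x)).
Proof.
move=> d1 d2.
have dl : differentiable (u1 \o (lsubmx : 'rV[R]_(n1 + n2) -> _)) x.
  by apply: differentiable_comp => //; exact: differentiable_lsubmx.
have dr : differentiable (u2 \o (rsubmx : 'rV[R]_(n1 + n2) -> _)) x.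
  by apply: differentiable_comp => //; exact: differentiable_rsubmx.
have El : 'D_v (u1 \o lsubmx) x = 'D_(lsubmx v) u1 (lsubmx x).
  rewrite deriveE// diff_comp//; last exact: differentiable_lsubmx.
  by rewrite diff_lin/= ?deriveE//; exact: continuous_lsubmx.
have Er : 'D_v (u2 \o rsubmx) x = 'D_(rsubmx v) u2 (rsubmx x).
  rewrite deriveE// diff_comp//; last exact: differentiable_rsubmx.
  by rewrite diff_lin/= ?deriveE//; exact: continuous_rsubmx.
have dlr i j : differentiable (fun y : 'rV[R]_(n1 + n2) =>
    row_mx (u1 (lsubmx y)) (u2 (rsubmx y)) i j) x.
  case: (split_ordP j) => l ->.
    by under eq_fun do rewrite row_mxEl; exact: (differentiable_entry i l dl).
  by under eq_fun do rewrite row_mxEr; exact: (differentiable_entry i l dr).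
rewrite derive_mx; last exact/diff_derivable/differentiable_mx.
apply/matrixP => i j; rewrite mxE -El -Er; case: (split_ordP j) => l ->.
  under eq_fun do rewrite row_mxEl.
  by rewrite row_mxEl derive_mx ?mxE//; exact: diff_derivable.
under eq_fun do rewrite row_mxEr.
by rewrite row_mxEr derive_mx ?mxE//; exact: diff_derivable.
Qed.
End RowMx.

Section ProductAtlas.
Context {R : realType} {M1 M2 : topologicalType} {n1 n2 : nat}.
Variables (A1 : atlas R M1 n1) (A2 : atlas R M2 n2).
Local Notation A := (prod_atlas A1 A2).
Implicit Types c : cidx A.

Lemma prod_image c (D1 : set M1) (D2 : set M2) :
  cmap c @` (D1 `*` D2) =
  [set x | (cmap c.1 @` D1) (lsubmx x) /\ (cmap c.2 @` D2) (rsubmx x)].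
Proof.
apply/seteqP; split=> [_ [p [D1p D2p] <-]|x [[p1 D1p e1] [p2 D2p e2]]] /=.
  by rewrite row_mxKl row_mxKr; split; [exists p.1|exists p.2].
by exists (p1, p2); [split|rewrite /= e1 e2 hsubmxK].
Qed.

Lemma prod_overlap c c' : overlap (A := A) c c' =
  [set x | overlap c.1 c'.1 (lsubmx x) /\ overlap c.2 c'.2 (rsubmx x)].
Proof.
by rewrite /overlap -prod_image; congr (_ @` _); apply/seteqP; split=> p /=; tauto.
Qed.

Lemma prod_crange c :
  crange c = [set x | crange c.1 (lsubmx x) /\ crange c.2 (rsubmx x)].
Proof. exact: prod_image. Qed.

Lemma open_submx (U1 : set 'rV[R]_n1) (U2 : set 'rV[R]_n2) : open U1 -> open U2 ->
  open [set x : 'rV[R]_(n1 + n2) | U1 (lsubmx x) /\ U2 (rsubmx x)].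
Proof.
move=> o1 o2; apply: openI; apply: open_comp => // x _.
  exact: continuous_lsubmx.
exact: continuous_rsubmx.
Qed.

Hypothesis sm1 : smooth_manifold A1.
Hypothesis sm2 : smooth_manifold A2.

Lemma prod_chart c : is_chart c.
Proof.
have [_ _ /(_ c.1) ch1 _ _] := sm1; have [_ _ /(_ c.2) ch2 _ _] := sm2.
have [ o1 r1 K1 m1 i1] := ch1; have [ o2 r2 K2 m2 i2] := ch2; split.
- rewrite openE => -[p1 p2] [/= cp1 cp2].
  by exists (cdom c.1, cdom c.2) => //=; split; exact: open_nbhs_nbhs.
- by rewrite prod_crange; exact: open_submx.
- by move=> [p1 p2] [/= cp1 cp2]; rewrite row_mxKl row_mxKr K1// K2.
- move=> [p1 p2] [/= cp1 cp2]; apply: continuous_rV => j; case: (split_ordP j) => l ->.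
    rewrite (_ : (fun y => _) = (fun N : 'rV[R]_n1 => N 0 l) \o (cmap c.1 \o fst)).
      by apply: continuous_comp; [apply: continuous_comp => /=; [exact: cvg_fst|exact: m1]|
        exact: coord_continuous].
    by apply/funext => y; rewrite row_mxEl.
  rewrite (_ : (fun y => _) = (fun N : 'rV[R]_n2 => N 0 l) \o (cmap c.2 \o snd)).
    by apply: continuous_comp; [apply: continuous_comp => /=; [exact: cvg_snd|exact: m2]|
      exact: coord_continuous].
  by apply/funext => y; rewrite row_mxEr.
- move=> x; rewrite prod_crange => -[/i1 xc1 /i2 xc2].
  have c1 : {for x, continuous (cinv c.1 \o lsubmx)}.
    apply: continuous_comp; first exact: continuous_lsubmx.
    exact: xc1.
  have c2 : {for x, continuous (cinv c.2 \o rsubmx)}.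
    apply: continuous_comp; first exact: continuous_rsubmx.
    exact: xc2.
  exact: (cvg_pair c1 c2).
Qed.

Lemma prod_transition c c' : smooth_on (overlap c c') (transition c c').
Proof.
have [_ _ ch1 _ t1] := sm1; have [_ _ ch2 _ t2] := sm2.
have o1 : open (overlap c.1 c'.1) by apply: chart_open => //; have [] := ch1 c'.1.
have o2 : open (overlap c.2 c'.2) by apply: chart_open => //; have [] := ch2 c'.2.
rewrite prod_overlap; apply/smooth_on_mxP; first exact: open_submx.
move=> i j k; rewrite (ord1 i); case: (split_ordP j) => l ->.
- rewrite (_ : (fun x => transition c c' x 0 (lshift n2 l)) =
      fun x : 'rV[R]_(n1 + n2) => transition c.1 c'.1 (lsubmx x) 0 l); last first.
    by apply/funext => x; rewrite /transition /= row_mxEl.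
  have /(smooth_on_mxP _ o1)/(_ 0 l k) := t1 c.1 c'.1.
  by move=> /(Ck_lsubmx (n2 := n2) o1); apply: CkS => x [].
- rewrite (_ : (fun x => transition c c' x 0 (rshift n1 l)) =
      fun x : 'rV[R]_(n1 + n2) => transition c.2 c'.2 (rsubmx x) 0 l); last first.
    by apply/funext => x; rewrite /transition /= row_mxEr.
  have /(smooth_on_mxP _ o2)/(_ 0 l k) := t2 c.2 c'.2.
  by move=> /(Ck_rsubmx (n1 := n1) o2); apply: CkS => x [].
Qed.

Lemma prod_jac c c' p : cdom c p -> cdom c' p ->
  jac c c' p = block_mx (jac c.1 c'.1 p.1) 0 0 (jac c.2 c'.2 p.2).
Proof.
have [_ _ ch1 _ t1] := sm1; have [_ _ ch2 _ t2] := sm2.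
move=> cp c'p; have [[cp1 cp2] [cp1' cp2']] := (cp, c'p).
apply/row_matrixP => i; rewrite !rowE.
have E := mul_jac prod_transition 'e_i cp c'p; rewrite E {E}.
rewrite -[in RHS](hsubmxK 'e_i) mul_row_block !mulmx0 addr0 add0r.
rewrite (mul_jac t1)// (mul_jac t2)//.
have d1 : differentiable (transition c.1 c'.1) (cmap c.1 p.1).
  by have /smooth_onP/(_ 0)[+ _] := t1 c.1 c'.1; apply; exists p.1.
have d2 : differentiable (transition c.2 c'.2) (cmap c.2 p.2).
  by have /smooth_onP/(_ 0)[+ _] := t2 c.2 c'.2; apply; exists p.2.
have := @derive_row_mx _ _ _ _ _ (transition c.1 c'.1) (transition c.2 c'.2) (cmap c p) 'e_i.
by rewrite /= row_mxKl row_mxKr; apply.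
Qed.

Section Metric.
Variables (g1 : tensor2 A1) (g2 : tensor2 A2) (f phi : M1 * M2 -> R).
Hypothesis metric1 : pseudo_riemannian g1.
Hypothesis metric2 : pseudo_riemannian g2.
Hypothesis f_smooth : smooth_fun A f.
Hypothesis f_gt0 : forall p, 0 < f p.
Hypothesis phi_smooth : smooth_fun A phi.
Hypothesis phi_gt0 : forall p, 0 < phi p.

(** Product coordinate changes have block diagonal Jacobians, so each block transforms as on its
    factor, and the scalars [f p ^+ 2] and [phi p ^+ 2] commute with the Jacobians. Positivity of
    [f] and [phi] keeps the determinant nonzero. *)
Lemma lyra_pseudo_riemannian :
  pseudo_riemannian (lyra_metric phi (twisted_metric g1 g2 f)).
Proof.
have [s1 tr1 sy1 un1] := metric1; have [s2 tr2 sy2 un2] := metric2.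
split=> [c|c c' p cp c'p|c p [cp1 cp2]|c p [cp1 cp2]].
- have [_ _ /(_ c.1)[_ o1 _ _ _] _ _] := sm1.
  have [_ _ /(_ c.2)[_ o2 _ _ _] _ _] := sm2.
  have [_ oc _ _ _] := prod_chart c.
  apply/(smooth_on_mxP _ oc) => i j k.
  have fC : Ck k (crange c) (f \o cinv c) by have /smooth_onP := @f_smooth c; exact.
  have phiC : Ck k (crange c) (phi \o cinv c) by have /smooth_onP := @phi_smooth c; exact.
  under eq_fun do rewrite /= /lyra_metric mxE expr2.
  apply: Ck_mul => //; first exact: Ck_mul.
  case: (split_ordP i) (split_ordP j) => a -> [] b ->.
  + under eq_fun do rewrite /twisted_metric block_mxEul /=.
    have /(smooth_on_mxP _ o1)/(_ a b k) := s1 c.1.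
    by move=> /(Ck_lsubmx (n2 := n2) o1); apply: CkS => x; rewrite prod_crange => -[].
  + by under eq_fun do rewrite /twisted_metric block_mxEur mxE; exact: Ck_cst.
  + by under eq_fun do rewrite /twisted_metric block_mxEdl mxE; exact: Ck_cst.
  + under eq_fun do rewrite /twisted_metric block_mxEdr mxE /= expr2.
    apply: Ck_mul => //; first exact: Ck_mul.
    have /(smooth_on_mxP _ o2)/(_ a b k) := s2 c.2.
    by move=> /(Ck_rsubmx (n1 := n1) o2); apply: CkS => x; rewrite prod_crange => -[].
- have [[cp1 cp2] [cp1' cp2']] := (cp, c'p).
  rewrite prod_jac// /lyra_metric /twisted_metric.
  rewrite tr_block_mx !trmx0 -scalemxAr -scalemxAl !mulmx_block.
  rewrite !(mulmx0, mul0mx, addr0, add0r) -scalemxAr -scalemxAl.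
  by rewrite -tr1// -tr2.
- by rewrite /lyra_metric /twisted_metric linearZ /= tr_block_mx !trmx0 linearZ /= sy1// sy2.
- rewrite /lyra_metric /twisted_metric unitmxZ ?unitfE ?expf_neq0 ?gt_eqF//.
  rewrite unitmxE det_ublock unitrM -!unitmxE un1//=.
  by rewrite unitmxZ ?un2// unitfE expf_neq0 ?gt_eqF.
Qed.
End Metric.
End ProductAtlas.

(** * Curvature and concurrent fields *)

Section ChartCalculus.
Context {R : realType} {M : topologicalType} {n : nat}.
Variables (A : atlas R M n) (c : cidx A).
Hypothesis cc : is_chart c.
Implicit Types (h : M -> R) (p q : M).

(** Smoothness in the one chart [c], as suits tensor components and Christoffel symbols, which are
    themselves attached to a chart. *)
Definition chart_smooth h := forall k, Ck k (crange c) (h \o cinv c).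

Let oU : open (crange c). Proof. by case: cc. Qed.

Let cinvK p : cdom c p -> cinv c (cmap c p) = p.
Proof. by have [_ _ cK _ _] := cc; exact: cK. Qed.

Let cmapP p : cdom c p -> crange c (cmap c p). Proof. by exists p. Qed.

Lemma chart_smooth_cst (a : R) : chart_smooth (fun=> a).
Proof. by move=> k; exact: Ck_cst. Qed.

Lemma chart_smoothD h h' : chart_smooth h -> chart_smooth h' ->
  chart_smooth (fun q => h q + h' q).
Proof. by move=> hs hs' k; exact: (Ck_add oU (hs k) (hs' k)). Qed.

Lemma chart_smoothB h h' : chart_smooth h -> chart_smooth h' ->
  chart_smooth (fun q => h q - h' q).
Proof. by move=> hs hs' k; exact: (CkB oU (hs k) (hs' k)). Qed.

Lemma chart_smoothM h h' : chart_smooth h -> chart_smooth h' ->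
  chart_smooth (fun q => h q * h' q).
Proof. by move=> hs hs' k; exact: (Ck_mul oU (hs k) (hs' k)). Qed.

Lemma chart_smooth_sum (I : Type) (r : seq I) (P : pred I) (h : I -> M -> R) :
  (forall i, chart_smooth (h i)) -> chart_smooth (fun q => \sum_(i <- r | P i) h i q).
Proof. by move=> hs k; apply: (Ck_sum _ _ oU) => i; exact: hs. Qed.

Lemma chart_smooth_prod (I : Type) (r : seq I) (P : pred I) (h : I -> M -> R) :
  (forall i, chart_smooth (h i)) -> chart_smooth (fun q => \prod_(i <- r | P i) h i q).
Proof. by move=> hs k; apply: (Ck_prod _ _ oU) => i; exact: hs. Qed.

Lemma eq_chart_smooth h h' : (forall q, cdom c q -> h q = h' q) ->
  chart_smooth h -> chart_smooth h'.
Proof.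
move=> hh' hs k; apply: (eq_Ck oU) (hs k) => _ [q cq <-] /=.
by rewrite cinvK// hh'.
Qed.

Lemma pd_cinv i h x : crange c x -> pd c i h (cinv c x) = 'D_('e_i) (h \o cinv c) x.
Proof. by case=> q cq <-; rewrite /pd cinvK. Qed.

Lemma chart_smooth_pd i h : chart_smooth h -> chart_smooth (pd c i h).
Proof.
move=> hs k; have [_ D] := hs k.+1.
by apply: (eq_Ck oU) (D i) => x Ux; rewrite /= pd_cinv.
Qed.

Lemma chart_smooth_diff h p : chart_smooth h -> cdom c p ->
  differentiable (h \o cinv c) (cmap c p).
Proof. by move=> hs cp; exact: Ck_diff (hs 0) (cmapP cp). Qed.

Let derivable_chart h p v : chart_smooth h -> cdom c p -> derivable (h \o cinv c) (cmap c p) v.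
Proof. by move=> hs cp; exact/diff_derivable/chart_smooth_diff. Qed.

Lemma eq_pd i h h' p : (forall q, cdom c q -> h q = h' q) -> cdom c p ->
  pd c i h p = pd c i h' p.
Proof.
move=> hh' cp; apply: near_eq_derive.
apply: filterS (open_nbhs_nbhs (conj oU (cmapP cp))) => _ [q cq <-] /=.
by rewrite cinvK// hh'.
Qed.

Lemma pd_cst i (a : R) p : pd c i (fun=> a) p = 0.
Proof. exact: derive_cst. Qed.

Lemma pdB i h h' p : chart_smooth h -> chart_smooth h' -> cdom c p ->
  pd c i (fun q => h q - h' q) p = pd c i h p - pd c i h' p.
Proof. by move=> hs hs' cp; apply: deriveB; exact: derivable_chart. Qed.

Lemma pdM i h h' p : chart_smooth h -> chart_smooth h' -> cdom c p ->
  pd c i (fun q => h q * h' q) p = h p * pd c i h' p + h' p * pd c i h p.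
Proof.
move=> hs hs' cp.
have := @deriveM _ _ (h \o cinv c) (h' \o cinv c) (cmap c p) 'e_i
  (derivable_chart hs cp) (derivable_chart hs' cp).
by rewrite /pd /= cinvK.
Qed.

Lemma pd_sum i m (h : 'I_m -> M -> R) p : (forall j, chart_smooth (h j)) -> cdom c p ->
  pd c i (fun q => \sum_j h j q) p = \sum_j pd c i (h j) p.
Proof.
move=> hs cp; rewrite /pd -derive_sum; last by move=> j; exact: derivable_chart.
by congr ('D_('e_i) _ _); apply/funext => x; rewrite fct_sumE.
Qed.

Lemma pd_comm i j h p : chart_smooth h -> cdom c p ->
  pd c j (pd c i h) p = pd c i (pd c j h) p.
Proof.
move=> hs cp; have := Ck_derive_comm i j oU (hs 2) (cmapP cp).
have E l l' : pd c l (pd c l' h) p =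
    'D_('e_l) (fun y => 'D_('e_l') (h \o cinv c) y) (cmap c p).
  apply: near_eq_derive.
  apply: filterS (open_nbhs_nbhs (conj oU (cmapP cp))) => x Ux /=.
  exact: pd_cinv.
by rewrite !E.
Qed.

Lemma chart_smooth_det m (B : M -> 'M[R]_m) :
  (forall i j, chart_smooth (fun q => B q i j)) -> chart_smooth (fun q => \det (B q)).
Proof.
move=> Bs; apply: chart_smooth_sum => s; apply: chart_smoothM.
  exact: chart_smooth_cst.
by apply: chart_smooth_prod => i.
Qed.

(** Cramer's formula: the entries of the inverse are cofactors, polynomial in the entries of [B],
    divided by the nonvanishing determinant. *)
Lemma chart_smooth_invmx m (B : M -> 'M[R]_m) : (forall q, cdom c q -> B q \in unitmx) ->
  (forall i j, chart_smooth (fun q => B q i j)) ->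
  forall i j, chart_smooth (fun q => invmx (B q) i j).
Proof.
move=> Bu Bs i j.
apply: (@eq_chart_smooth (fun q => (\det (B q))^-1 * cofactor (B q) j i)).
  by move=> q /Bu qu; rewrite /invmx qu !mxE.
apply: chart_smoothM.
  move=> k; apply: (Ck_inv oU _ (chart_smooth_det Bs k)) => _ [q cq <-] /=.
  by rewrite cinvK//; have := Bu q cq; rewrite unitmxE unitfE.
apply: chart_smoothM; first exact: chart_smooth_cst.
apply: chart_smooth_det => a b.
by under eq_fun do rewrite !mxE; exact: Bs.
Qed.
End ChartCalculus.

(** * Identities satisfied by a concurrent field in a chart *)

Section Concurrent.
Context {R : realType} {M : topologicalType} {n : nat}.
Variable A : atlas R M n.
Hypothesis charts : forall c : cidx A, is_chart c.
Hypothesis smooth_transition : forall c c' : cidx A, smooth_on (overlap c c') (transition c c').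
Hypothesis hM : hausdorff_space M.
Variables (g : tensor2 A) (Z : vfield A).
Hypothesis metric : pseudo_riemannian g.
Hypothesis Z_smooth : smooth_vfield Z.
Hypothesis Z_concurrent : concurrent g Z.
Implicit Types (c : cidx A) (p q : M).

Let g_smooth c i j : chart_smooth c (fun q => g c q i j).
Proof.
have [+ _ _ _] := metric => /(_ c) gs k; have [_ oR _ _ _] := charts c.
by have /(smooth_on_mxP _ oR) := gs; exact.
Qed.

Let zs c k : chart_smooth c (fun q => Z c q 0 k).
Proof.
have [/(_ c) Zs _] := Z_smooth; have [_ oR _ _ _] := charts c => m.
by have /(smooth_on_mxP _ oR) := Zs; exact.
Qed.

Lemma christoffel_smooth c k i j : chart_smooth c (christoffel g c k i j).
Proof.
have [_ _ _ gU] := metric; have cc := charts c.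
apply: chart_smoothM => //; first exact: chart_smooth_cst.
apply: chart_smooth_sum => // l; apply: chart_smoothM => //.
  by apply: chart_smooth_invmx => // q; exact: gU.
by apply: chart_smoothB => //; first apply: chart_smoothD => //; exact: chart_smooth_pd.
Qed.

Lemma ricci_smooth c i j : chart_smooth c (fun q => ricci g c q i j).
Proof.
have cc := charts c; under eq_fun do rewrite mxE.
apply: chart_smooth_sum => // k; apply: chart_smoothD => //.
  by apply: chart_smoothB => //; apply: chart_smooth_pd => //; exact: christoffel_smooth.
apply: chart_smooth_sum => // m.
by apply: chart_smoothB => //; apply: chart_smoothM => //; exact: christoffel_smooth.
Qed.


(** This and the compatibility with the metric come from reading [christoffelP] backwards, with the
    Christoffel symbols themselves as [G]. *)
Lemma christoffel_sym c k i j p : cdom c p ->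
  christoffel g c k i j p = christoffel g c k j i p.
Proof.
move=> cp.
have [_ /(_ (fun _ _ _ => erefl))[+ _]] :=
  christoffelP (fun k i j => christoffel g c k i j p) (charts c) metric cp.
exact.
Qed.

Lemma metric_compat c i j k p : cdom c p ->
  pd c i (fun q => g c q j k) p =
  \sum_m (christoffel g c m i j p * g c p m k + christoffel g c m i k p * g c p j m).
Proof.
move=> cp.
have [_ /(_ (fun _ _ _ => erefl))[_]] :=
  christoffelP (fun k i j => christoffel g c k i j p) (charts c) metric cp.
exact.
Qed.

(* Concurrency is a condition on global fields [X]; it becomes pointwise because
   every tangent vector extends to a global smooth field. *)
Lemma concurrent_pd c i k p : cdom c p ->
  pd c i (fun q => Z c q 0 k) p =
  (i == k)%:R - \sum_j christoffel g c k i j p * Z c p 0 j.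
Proof.
move=> cp; have [X Xs Xp] := exists_vfield charts smooth_transition hM 'e_i cp.
have /rowP/(_ k) := Z_concurrent Xs cp; rewrite /cov_deriv Xp !mxE.
rewrite (bigD1 i)//= [X in _ + X]big1 => [|l li]; last by rewrite mxE (negbTE li) andbF mul0r.
by rewrite !mxE !eqxx mul1r addr0 [k == i]eq_sym => <-; rewrite addrK.
Qed.

(* R(X, Y)Z = nabla_X Y - nabla_Y X - [X, Y] = 0 since nabla_X Z = X. *)
Lemma concurrent_riemann c k m i p : cdom c p ->
  \sum_l riemann g c k m i l p * Z c p 0 l = 0.
Proof.
move=> cp; have cc := charts c; have cs := christoffel_smooth.
(* Differentiating the system of [concurrent_pd] once more, and substituting it for the new first
   derivatives of [Z], expresses second derivatives through [S] (derivatives of Gamma), [Q]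
   (quadratic in Gamma) and one bare Christoffel symbol. *)
pose S a b := \sum_l pd c a (christoffel g c k b l) p * Z c p 0 l.
pose Q a b := \sum_j christoffel g c k a j p *
  (\sum_l christoffel g c j b l p * Z c p 0 l).
have T a b : pd c a (pd c b (fun q => Z c q 0 k)) p =
    Q b a - christoffel g c k b a p - S a b.
  rewrite (@eq_pd _ _ _ _ _ cc _ _ (fun q => (b == k)%:R -
      \sum_j christoffel g c k b j q * Z c q 0 j))//; last first.
    by move=> q cq; exact: concurrent_pd.
  have ts j : chart_smooth c (fun q => christoffel g c k b j q * Z c q 0 j).
    by apply: chart_smoothM => //; exact: cs.
  rewrite pdB//; [|exact: chart_smooth_cst|exact: chart_smooth_sum].
  rewrite pd_cst sub0r pd_sum//.
  have tE j : pd c a (fun q => christoffel g c k b j q * Z c q 0 j) p =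
      christoffel g c k b j p * (a == j)%:R - christoffel g c k b j p *
      (\sum_l christoffel g c j a l p * Z c p 0 l)
      + pd c a (christoffel g c k b j) p * Z c p 0 j.
    rewrite pdM//.
    by rewrite concurrent_pd// mulrBr [Z c p 0 j * _]mulrC.
  rewrite (eq_bigr _ (fun j _ => tE j)) big_split sumrB /= -/(S a b) -/(Q b a).
  rewrite (bigD1 a)//= eqxx mulr1 big1 => [|j ja]; last first.
    by rewrite eq_sym (negbTE ja) mulr0.
  rewrite addr0; move: (Q b a) (S a b) (christoffel _ _ _ _ _ _) => x y z; ring.
(* Equality of mixed partials is the integrability condition; the bare Christoffel symbols cancel by
   symmetry and what remains is the curvature applied to [Z]. *)
have TT := pd_comm cc i m (zs c k) cp; rewrite !T (christoffel_sym k i m cp) in TT.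
transitivity (S m i - S i m + (Q m i - Q i m)); last first.
  move: TT; move: (Q m i) (Q i m) (S m i) (S i m) (christoffel _ _ _ _ _ _) => x1 x2 x3 x4 x5; lra.
have QE a b : Q a b = \sum_l (\sum_j christoffel g c k a j p * christoffel g c j b l p) * Z c p 0 l.
  rewrite /Q; under eq_bigr do rewrite mulr_sumr.
  rewrite exchange_big /=; apply: eq_bigr => l _; rewrite mulr_suml.
  by apply: eq_bigr => j _; rewrite mulrA.
rewrite !QE /S -!sumrB -big_split; apply: eq_bigr => l _.
by rewrite /riemann sumrB !mulrDl !mulNr.
Qed.

Lemma concurrent_ricci c i p : cdom c p -> \sum_l ricci g c p i l * Z c p 0 l = 0.
Proof.
move=> cp; under eq_bigr do rewrite mxE mulr_suml.
by rewrite exchange_big big1// => m _; exact: concurrent_riemann.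
Qed.

(* At a zero of [Z], differentiate Ric(-, Z) = 0 and use nabla Z = id. *)
Lemma concurrent_ricci_zero c p : cdom c p -> Z c p = 0 -> ricci g c p = 0.
Proof.
move=> cp Zp; have cc := charts c; apply/matrixP => i m.
have zero : pd c m (fun q => \sum_l ricci g c q i l * Z c q 0 l) p = 0.
  rewrite (@eq_pd _ _ _ _ _ cc _ _ (fun=> 0))//; first exact: pd_cst.
  by move=> q; exact: concurrent_ricci.
have rs l : chart_smooth c (fun q => ricci g c q i l) by exact: ricci_smooth.
rewrite pd_sum// in zero; last by move=> l; exact: chart_smoothM.
have Z0 l : Z c p 0 l = 0 by rewrite Zp mxE.
(* At a zero of [Z] both the term with the derivative of Ric and the Christoffel correction in the
   derivative of [Z] vanish, leaving the Kronecker symbol. *)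
have tE l : pd c m (fun q => ricci g c q i l * Z c q 0 l) p = ricci g c p i l * (m == l)%:R.
  rewrite pdM// concurrent_pd// Z0 mul0r addr0 big1 ?subr0// => j _.
  by rewrite Z0 mulr0.
rewrite [RHS]mxE -zero (eq_bigr _ (fun l _ => tE l)) (bigD1 m)//= eqxx mulr1.
by rewrite big1 ?addr0// => l lm; rewrite eq_sym (negbTE lm) mulr0.
Qed.

(** Compatibility with the metric and absence of torsion give (L_Z g)(X, Y) = g(nabla_X Z, Y) + g(X,
    nabla_Y Z), and each summand is g(X, Y). *)
Lemma concurrent_lie_deriv c p : cdom c p -> lie_deriv Z g c p = 2 *: g c p.
Proof.
move=> cp; apply/matrixP => i j; rewrite !mxE.
pose G k a b := christoffel g c k a b p; pose z k := Z c p 0 k.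
have E k : Z c p 0 k * pd c k (fun q => g c q i j) p
     + g c p k j * pd c i (fun q => Z c q 0 k) p
     + g c p i k * pd c j (fun q => Z c q 0 k) p =
   (\sum_m z k * (G m i k * g c p m j) - \sum_m z m * (G k i m * g c p k j))
   + (\sum_m z k * (G m j k * g c p i m) - \sum_m z m * (G k j m * g c p i k))
   + ((i == k)%:R * g c p k j + (j == k)%:R * g c p i k).
  rewrite metric_compat// !concurrent_pd// big_split mulrDr !mulr_sumr /=.
  have s1 : \sum_m z k * (G m i k * g c p m j) = 
    \sum_m Z c p 0 k * (christoffel g c m k i p * g c p m j).
    by apply: eq_bigr => m _; rewrite christoffel_sym.
  have s2 : \sum_m z k * (G m j k * g c p i m) = 
    \sum_m Z c p 0 k * (christoffel g c m k j p * g c p i m).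
    by apply: eq_bigr => m _; rewrite christoffel_sym.
  have s3 a : \sum_m z m * (G k a m * g c p k j) = 
    g c p k j * \sum_m christoffel g c k a m p * Z c p 0 m.
    by rewrite mulr_sumr; apply: eq_bigr => m _; rewrite mulrC [RHS]mulrC mulrAC.
  have s4 a : \sum_m z m * (G k a m * g c p i k) = 
    g c p i k * \sum_m christoffel g c k a m p * Z c p 0 m.
    by rewrite mulr_sumr; apply: eq_bigr => m _; rewrite mulrC [RHS]mulrC mulrAC.
  rewrite s1 s2 s3 s4 !mulrBr.
  move: (\sum_m _) (\sum_m _) (\sum_m _) (\sum_m _) (g c p k j) (g c p i k) (_%:R) (_%:R).
  by move=> x1 x2 x3 x4 x5 x6 x7 x8; ring.
rewrite (eq_bigr _ (fun k _ => E k)) !big_split /= !sumrN.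
(* The Christoffel terms do not cancel for a fixed [k], only after summing over [k] and exchanging
   the two summation indices. *)
have X1 : \sum_k \sum_m z k * (G m i k * g c p m j) =
          \sum_k \sum_m z m * (G k i m * g c p k j) by rewrite exchange_big.
have X2 : \sum_k \sum_m z k * (G m j k * g c p i m) =
          \sum_k \sum_m z m * (G k j m * g c p i k) by rewrite exchange_big.
rewrite X1 X2 !subrr !add0r.
rewrite (bigD1 i)//= big1 => [|k ki]; last by rewrite eq_sym (negbTE ki) mul0r.
rewrite (bigD1 j)//= big1 => [|k kj]; last by rewrite eq_sym (negbTE kj) mul0r.
by rewrite !eqxx !mul1r !addr0 mulr2n mulrDl mul1r.
Qed.
End Concurrent.

Lemma concurrent_soliton_ricci_flat {R : realType} {M : topologicalType} {n : nat}
    (A : atlas R M n) (g : tensor2 A) (Z : vfield A) (lambda : M -> R) (rho : R) :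
  (forall c : cidx A, is_chart c) ->
  (forall c c' : cidx A, smooth_on (overlap c c') (transition c c')) ->
  hausdorff_space M -> pseudo_riemannian g ->
  almost_ricci_bourguignon g Z lambda rho -> concurrent g Z ->
  forall (c : cidx A) p, cdom c p -> ricci g c p = 0.
Proof.
move=> charts tr hM metric [Zs _ sol] Zc c p cp.
have [Z0|/eqP Z0] := eqVneq (Z c p) 0.
  exact: (concurrent_ricci_zero charts tr hM metric Zs Zc cp Z0).
have Ric := sol c p cp; rewrite /= (concurrent_lie_deriv charts tr hM metric Zc cp) in Ric.
have [_ _ _ /(_ c p cp) gU] := metric.
move: Ric; set kap := _ + _ * _; rewrite scalerA mulVf// scale1r => Ric.
have {}Ric : ricci g c p = (kap - 1) *: g c p.
  by rewrite scalerBl scale1r -Ric addrK.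
suff k0 : kap - 1 = 0 by rewrite Ric k0 scale0r.
apply/eqP; apply: contra_notT Z0 => k0.
have : ricci g c p *m (Z c p)^T = 0.
  apply/matrixP => i j; rewrite (ord1 j) [LHS]mxE [RHS]mxE.
  rewrite -[RHS](concurrent_ricci charts tr hM metric Zs Zc i cp).
  by apply: eq_bigr => l _; rewrite [X in _ * X]mxE.
(* With [kap - 1] nonzero, g(-, Z) = 0 at [p], and nondegeneracy forces [Z c p = 0], including when
   [Z] is null. *)
rewrite Ric -scalemxAl => /eqP; rewrite scaler_eq0 (negbTE k0) /= => /eqP gZ.
by apply: trmx_inj; rewrite trmx0 -(mulKmx gU (Z c p)^T) gZ mulmx0.
Qed.

Theorem corollary5p5 (R : realType) (M1 M2 : topologicalType) (n1 n2 : nat)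
    (A1 : atlas R M1 n1) (A2 : atlas R M2 n2)
    (g1 : tensor2 A1) (g2 : tensor2 A2) (f phi : M1 * M2 -> R)
    (Z : vfield (prod_atlas A1 A2)) (lambda : M1 * M2 -> R) (rho : R)
    (n1_gt0 : (0 < n1)%N) (n2_gt0 : (0 < n2)%N) (n_ge3 : (3 <= n1 + n2)%N)
    (smM1 : smooth_manifold A1) (smM2 : smooth_manifold A2)
    (metric1 : pseudo_riemannian g1) (metric2 : pseudo_riemannian g2)
    (f_smooth : smooth_fun (prod_atlas A1 A2) f) (f_gt0 : forall p, 0 < f p)
    (phi_smooth : smooth_fun (prod_atlas A1 A2) phi)
    (phi_gt0 : forall p, 0 < phi p)
    (M_connected : connected [set: M1 * M2]) :
  let gL := lyra_metric phi (twisted_metric g1 g2 f) in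
  almost_ricci_bourguignon gL Z lambda rho ->
  concurrent gL Z ->
  exists mu : R,
    [/\ einstein_with gL mu,
        (forall p, lambda p = (1 - (n1 + n2)%:R * rho) * mu + 1),
        ricci_bourguignon gL Z lambda rho,
        (rho != (n1 + n2)%:R^-1 ->
           forall p, mu = (lambda p - 1) / (1 - (n1 + n2)%:R * rho)) &
        (rho = (n1 + n2)%:R^-1 -> forall p, lambda p = 1)].
Proof.
move=> gL sol Zc; pose A := prod_atlas A1 A2.
have [h1 _ ch1 cover1 _] := smM1; have [h2 _ ch2 cover2 _] := smM2.
have charts : forall c : cidx A, is_chart c by exact: prod_chart smM1 smM2.
have tr : forall c c' : cidx A, smooth_on (overlap c c') (transition c c').
  exact: prod_transition smM1 smM2.
have hM := hausdorff_prod h1 h2.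
have metric : pseudo_riemannian gL by exact: lyra_pseudo_riemannian.
have flat c p : cdom c p -> ricci gL c p = 0.
  exact: (concurrent_soliton_ricci_flat charts tr hM metric sol Zc).
have lambda1 p : lambda p = 1.
  have [[c1 cp1] [c2 cp2]] := (cover1 p.1, cover2 p.2).
  pose c : cidx A := (c1, c2); have cp : cdom c p by [].
  have [_ _ /(_ c p cp)] := sol.
  have scal0 : scalar_curv gL c p = 0.
    by rewrite /scalar_curv (flat c p cp) big1// => j _; rewrite big1// => k _; rewrite mxE mulr0.
  rewrite scal0 (flat c p cp) (concurrent_lie_deriv charts tr hM metric Zc cp).
  rewrite add0r mulr0 addr0 scalerA mulVf// scale1r => gE.
  have [_ _ _ /(_ c p cp) gU] := metric.
  (* The relation g = lambda g is multiplied by the inverse of g and read in one diagonal entry,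
     which exists because the dimension is positive. *)
  have : (lambda p - 1) *: (1%:M : 'M[R]_(n1 + n2)) = 0.
    by rewrite -(mulmxV gU) scalemxAl scalerBl -gE scale1r subrr mul0mx.
  have n0 : (0 < n1 + n2)%N by rewrite addn_gt0 n1_gt0.
  move=> /matrixP/(_ (Ordinal n0) (Ordinal n0)); rewrite !mxE eqxx mulr1.
  by move=> /eqP; rewrite subr_eq0 => /eqP.
(* Ricci flatness dictates the witness 0; with [lambda p - 1 = 0] the quotient formula for mu
   becomes [0 = 0]. *)
exists 0; split=> [c p cp|p||_ p|_ p].
- by rewrite flat// scale0r.
- by rewrite lambda1 mulr0 add0r.
- by split=> //; exists 1.
- by rewrite lambda1 subrr mul0r.
- exact: lambda1.
Qed.
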